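(* Let $r$ and $\ell$ be two positive integers with $\ell\le r-1$, and let $n$ be a positive integer. Let $h_{n,0}(x),h_{n,1}(x),\dots,h_{n,r-1}(x)$ be the polynomials such that $$\left(1+x+x^2+\cdots+x^{\ell}\right)^n=h_{n,0}(x^r)+x h_{n,1}(x^r)+\cdots+x^{r-1}h_{n,r-1}(x^r).$$ Then the polynomial sequence $\left(h_{n,r-1}(x),\dots,h_{n,1}(x),h_{n,0}(x)\right)$ is interlacing.
   Context: The polynomials $h_{n,0},\dots,h_{n,r-1}$ are uniquely determined by the displayed identity. Interlacing of two polynomials: let $f(x)$ and $g(x)$ be real-rooted polynomials with positive leading coefficients, with zeros (listed with multiplicity in weakly decreasing order) $u_1\ge u_2\ge\cdots$ and $v_1\ge v_2\ge\cdots$, respectively. Then $g$ interlaces $f$, written $g\ll f$, if either $\deg f=\deg g=d$ and $v_d\le u_d\le v_{d-1}\le\cdots\le v_2\le u_2\le v_1\le u_1$, or $\deg f=\deg g+1=d$ and $u_d\le v_{d-1}\le\cdots\le v_2\le u_2\le v_1\le u_1$. By convention, $0\ll f$ and $f\ll 0$ for any real-rooted polynomial $f$, where the zero polynomial is regarded as real-rooted (so also $0\ll 0$). Interlacing sequence: a sequence $(f_1(x),\dots,f_m(x))$ of real-rooted polynomials, each of which is either zero or has positive leading coefficient, is interlacing if $f_i(x)\ll f_j(x)$ for all $1\le i<j\le m$. *)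

(* Defs.v *)
From HB Require Import structures.
From mathcomp Require Import all_boot all_order all_algebra.
From mathcomp Require Import reals complex.

Set Implicit Arguments.
Unset Strict Implicit.
Unset Printing Implicit Defensive.

Import Order.TTheory GRing.Theory Num.Theory.
Local Open Scope ring_scope.

(* The zero polynomial is real-rooted by convention. *)
Definition real_rooted (R : realType) (f : {poly R}) : Prop :=
  f != 0 ->
  forall z : R[i], root (map_poly (real_complex R) f) z -> complex.Im z = 0.

(* [u] lists the zeros of [f], with multiplicity, in weakly decreasing order.
   Meaningful only when [f] is nonzero. *)
Definition zero_list (R : realType) (f : {poly R}) (u : seq R) : Prop :=
  sorted >=%R u /\ f = lead_coef f *: \prod_(z <- u) ('X - z%:P).

(* [interlaces g f] is g << f.  Indices of the zero lists start at 0.  The same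
   two families of inequalities serve both cases: when deg f = deg g = d they
   form the chain v_d <= u_d <= v_(d-1) <= ... <= v_1 <= u_1, and when
   deg f = deg g + 1 = d the chain u_d <= v_(d-1) <= ... <= v_1 <= u_1. *)
Definition interlaces (R : realType) (g f : {poly R}) : Prop :=
  [\/ g = 0 /\ real_rooted f,
      f = 0 /\ real_rooted g
    | [/\ real_rooted f /\ real_rooted g,
          0 < lead_coef f /\ 0 < lead_coef g,
          size f = size g \/ size f = (size g).+1
        & exists u v : seq R,
            [/\ zero_list f u,
                zero_list g v,
                forall i, (i < size v)%N -> v`_i <= u`_i
              & forall i, (i.+1 < size u)%N -> u`_i.+1 <= v`_i]]].

Definition interlacing_sequence (R : realType) (m : nat)
    (f : 'I_m -> {poly R}) : Prop :=
  (forall i, real_rooted (f i) /\ (f i = 0 \/ 0 < lead_coef (f i))) /\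
  (forall i j : 'I_m, (i < j)%N -> interlaces (f i) (f j)).

(* Main.v *)
(* For polynomials g, f with real coefficients, g << f is replaced by the pointwise
   condition Im (conj g(z) * f(z)) >= 0 on the upper half-plane, which is additive
   in f and in g. Put F_i = h_(r-1-i) for i < r and F_(i+r) = x F_i. Multiplying
   by 1 + x + ... + x^l replaces each F_i by the window sum F_i + ... + F_(i+l), and
   as l < r such sums preserve the condition F_i << F_j for i <= j <= i + r: the
   antisymmetric contributions cancel, and the only new ones compare a sum S
   with z S.
   At a point z of the upper half-plane not all h_k vanish, since otherwise the
   r distinct roots w of w^r = z would be roots of 1 + x + ... + x^l. Looking at the
   argument of h_i / h_j near a nonreal zero of h_i then shows that there is none.
   Finally the half-plane condition yields interlacing of the zeros by peeling off
   the largest zero b of f: expanding g / f in partial fractions, whose residues are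
   positive, gives f << (x - b) g, that is f / (x - b) << g, and one exchanges the
   roles of f and g. *)

Require Import Defs.
From HB Require Import structures.
From mathcomp Require Import all_boot all_order all_algebra.
From mathcomp Require Import reals complex.
From mathcomp Require Import separable ring lra zify.

Set Implicit Arguments.
Unset Strict Implicit.
Unset Printing Implicit Defensive.

Import Order.TTheory GRing.Theory Num.Theory.
Local Open Scope ring_scope.

Local Notation toC := (map_poly (real_complex _)).
Local Notation prodXsub s := (\prod_(w <- s) ('X - w%:P)).

(** * Window sums at a point of the upper half-plane *)

Section Cross.

Variable R : realType.
Implicit Types a b c : R[i].

(* Im (conj a * b) *)
Definition cross a b : R :=
  complex.Re a * complex.Im b - complex.Im a * complex.Re b.

Lemma crossC a b : cross a b = - cross b a.
Proof. by rewrite /cross; ring. Qed.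

Lemma crossxx a : cross a a = 0.
Proof. by rewrite /cross; ring. Qed.

Lemma cross0l a : cross 0 a = 0.
Proof. by rewrite /cross /=; ring. Qed.

Lemma cross0r a : cross a 0 = 0.
Proof. by rewrite /cross /=; ring. Qed.

Lemma crossDl a b c : cross (a + b) c = cross a c + cross b c.
Proof. by case: a b c => [? ?] [? ?] [? ?]; rewrite /cross /=; ring. Qed.

Lemma crossDr a b c : cross a (b + c) = cross a b + cross a c.
Proof. by case: a b c => [? ?] [? ?] [? ?]; rewrite /cross /=; ring. Qed.

Lemma crossMM a b c :
  cross (c * a) (c * b) = (complex.Re c ^+ 2 + complex.Im c ^+ 2) * cross a b.
Proof. by case: a b c => [? ?] [? ?] [? ?]; rewrite /cross /=; ring. Qed.

Lemma crossxM a c :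
  cross a (c * a) = (complex.Re a ^+ 2 + complex.Im a ^+ 2) * complex.Im c.
Proof. by case: a c => [? ?] [? ?]; rewrite /cross /=; ring. Qed.

Lemma cross_suml I (s : seq I) (F : I -> R[i]) b :
  cross (\sum_(i <- s) F i) b = \sum_(i <- s) cross (F i) b.
Proof.
by elim/big_rec2: _ => [|i y x _ <-]; rewrite ?cross0l ?crossDl.
Qed.

Lemma cross_sumr I (s : seq I) (F : I -> R[i]) a :
  cross a (\sum_(i <- s) F i) = \sum_(i <- s) cross a (F i).
Proof.
by elim/big_rec2: _ => [|i y x _ <-]; rewrite ?cross0r ?crossDr.
Qed.

End Cross.

Section Windows.

Variables (R : realType) (r : nat) (z : R[i]) (F : nat -> R[i]).
Hypothesis Imz_ge0 : 0 <= complex.Im z.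
Hypothesis F_shift : forall i, F (i + r)%N = z * F i.
Hypothesis F_cross : forall i j, (i <= j <= i + r)%N -> 0 <= cross (F i) (F j).

Let S a b := \sum_(a <= i < b) F i.

(** Bilinearity suffices: indices of the two windows satisfy [i < b <= c + 1 <= j + 1] and
    [j < d <= a + r + 1 <= i + r + 1]. *)
Let cross_separated a b c d :
  (b <= c.+1)%N -> (d <= (a + r).+1)%N -> 0 <= cross (S a b) (S c d).
Proof.
move=> le_bc le_da; rewrite cross_suml big_nat; apply: sumr_ge0 => i /andP[ai ib].
rewrite cross_sumr big_nat; apply: sumr_ge0 => j /andP[cj jd].
by apply: F_cross; lia.
Qed.

(** The common part [S d L] pairs with itself to zero; the remaining pairs of windows are
    separated. *)
Let cross_overlap L d m :
  (d <= m)%N -> (L <= m)%N -> (m <= r)%N -> 0 <= cross (S 0 L) (S d m).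
Proof.
move=> dm Lm mr; have [Ld|/ltnW dL] := leqP L d.
  by apply: cross_separated; lia.
have -> : S d m = S d L + S L m by rewrite /S -big_cat_nat.
rewrite crossDr addr_ge0 //; last by apply: cross_separated; lia.
have -> : S 0 L = S 0 d + S d L by rewrite /S -big_cat_nat.
by rewrite crossDl crossxx addr0; apply: cross_separated; lia.
Qed.

Lemma cross_window0 L d : (L <= r)%N -> (d <= r)%N ->
  0 <= cross (\sum_(0 <= i < L) F i) (\sum_(d <= i < d + L) F i).
Proof.
rewrite -!/(S _ _) => Lr dr.
have [dLr|/ltnW rdL] := leqP (d + L) r; first by apply: cross_overlap; lia.
(* The last [e] terms wrap around: [S r (r + e) = z * S 0 e], whose pairing with [S 0 e] is |S 0
   e|^2 Im z. *)
have [e de] : {e | (d + L = r + e)%N} by exists (d + L - r)%N; lia.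
rewrite de; have -> : S d (r + e) = S d r + S r (r + e).
  by rewrite /S -big_cat_nat // leq_addr.
rewrite crossDr addr_ge0 //; first by apply: cross_overlap; lia.
have -> : S 0 L = S 0 e + S e L by rewrite /S -big_cat_nat //; lia.
rewrite crossDl addr_ge0 //; last by apply: cross_separated; lia.
have -> : S r (r + e) = z * S 0 e.
  rewrite /S -{1}(add0n r) (addnC r e) big_addn addnK mulr_sumr.
  by apply: eq_bigr => i _.
by rewrite crossxM mulr_ge0 // addr_ge0 // sqr_ge0.
Qed.

End Windows.

Lemma cross_window (R : realType) (r : nat) (z : R[i]) (F : nat -> R[i]) (L : nat) :
  0 <= complex.Im z -> (forall i, F (i + r)%N = z * F i) ->
  (forall i j, (i <= j <= i + r)%N -> 0 <= cross (F i) (F j)) -> (L <= r)%N ->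
  forall i j, (i <= j <= i + r)%N ->
  0 <= cross (\sum_(k < L) F (i + k)%N) (\sum_(k < L) F (j + k)%N).
Proof.
move=> Imz Fs Fc Lr i j ij.
have [d [jE dr]] : {d | j = (d + i)%N /\ (d <= r)%N} by exists (j - i)%N; lia.
have := @cross_window0 R r z (fun k => F (k + i)%N) Imz _ _ L d Lr dr.
have -> : \sum_(d <= k < d + L) F (k + i)%N = \sum_(k < L) F (j + k)%N.
  rewrite -[X in \sum_(X <= _ < _) _]add0n big_addn addKn big_mkord jE.
  by apply: eq_bigr => k _; congr F; lia.
rewrite big_mkord; under eq_bigr do rewrite addnC; apply.
  by move=> k; rewrite addnAC Fs.
by move=> a b ab; apply: Fc; lia.
Qed.

(** * Sections along residue classes *)

(** All exponents in the summand [j] are congruent to [j] modulo [r], so each coefficient comes from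
    a single summand. *)
Lemma coef_sum_mul_comp_Xn (R : comNzRingType) (r : nat) (h : 'I_r -> {poly R})
    (k : 'I_r) (m : nat) :
  (\sum_(j < r) 'X^j * (h j \Po 'X^r))`_(m * r + k) = (h k)`_m.
Proof.
have r_gt0 : (0 < r)%N by case: k => ? /= /(leq_trans _) ->.
rewrite coef_sum (bigD1 k) //= coefXnM ltnNge leq_addl /= addnK.
rewrite coef_comp_poly_Xn // dvdn_mull // mulnK // big1 ?addr0 // => j jk.
rewrite coefXnM coef_comp_poly_Xn //; case: ifP => // /negbT; rewrite -leqNgt => le_j.
case: ifP => // /dvdnP[q /eqP]; rewrite -(eqn_add2r j) subnK //.
move=> /eqP /(congr1 (modn^~ r)).
rewrite !modnMDl !modn_small // => kj.
by case/eqP: jk; apply/val_inj.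
Qed.

(* Coefficient [m] is that of ['X^(r * m + r - 1 - i)] in [P]. For [i < r] this is
   the section of [P] along the residue class of [r - 1 - i]; beyond, the sections
   repeat up to a factor ['X]. *)
Definition sect (R : nzRingType) (r i : nat) (P : {poly R}) : {poly R} :=
  \poly_(m < size P + i) (if (i < r * m.+1)%N then P`_(r * m.+1 - i.+1)%N else 0).

Section Sect.

Variables (R : comNzRingType) (r : nat).
Hypothesis r_gt0 : (0 < r)%N.
Implicit Type P : {poly R}.

Lemma coef_sect i P m :
  (sect r i P)`_m = (if (i < r * m.+1)%N then P`_(r * m.+1 - i.+1)%N else 0).
Proof.
rewrite coef_poly; case: ltnP => // le_m; case: ifP => // _.
(* The truncation at [size P + i] loses nothing: beyond it, [r * m.+1 - i.+1] is at least [m - i],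
   hence at least [size P]. *)
rewrite nth_default //; have := leq_pmull m.+1 r_gt0.
move: (size P) (r * _)%N le_m => *; lia.
Qed.

Lemma sect_addr i P : sect r (i + r) P = 'X * sect r i P.
Proof.
apply/polyP => -[|m]; rewrite mulrC coefMX !coef_sect /=.
  by rewrite muln1 ltnNge leq_addl.
by rewrite mulnS addnC ltn_add2l -addnS subnDl.
Qed.

(** Indexing by decreasing residue turns multiplication by ['X^j] into a plain shift of the index,
    without wrap-around. *)
Lemma sect_XnM i j P : sect r i ('X^j * P) = sect r (i + j) P.
Proof.
apply/polyP => m; rewrite !coef_sect coefXnM.
case: (ltnP i _) => im; last by rewrite ifF //; lia.
case: ltnP => jm; first by rewrite ifF //; lia.
rewrite ifT; last by lia.
by congr nth; lia.
Qed.

Lemma sect_sum i n (F : 'I_n -> {poly R}) :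
  sect r i (\sum_(j < n) F j) = \sum_(j < n) sect r i (F j).
Proof.
apply/polyP => m; rewrite coef_sum coef_sect; under [RHS]eq_bigr do rewrite coef_sect.
by case: ifP => _; [rewrite coef_sum | rewrite big1].
Qed.

Lemma sect_geom_mul i L P :
  sect r i ((\sum_(j < L) 'X^j) * P) = \sum_(j < L) sect r (i + j) P.
Proof.
by rewrite mulr_suml sect_sum; apply: eq_bigr => j _; rewrite sect_XnM.
Qed.

Lemma sect_decomposition (h : 'I_r -> {poly R}) (i : 'I_r) :
  sect r i (\sum_(k < r) 'X^k * (h k \Po 'X^r)) = h (rev_ord i).
Proof.
have ir := ltn_ord i.
apply/polyP => m; rewrite coef_sect ifT; last by nia.
by rewrite -(coef_sum_mul_comp_Xn h); congr nth => /=; nia.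
Qed.

Lemma sect1 i : sect r i (1 : {poly R}) = if (r %| i.+1)%N then 'X^(i %/ r) else 0.
Proof.
apply/polyP => m; rewrite coef_sect coef1; case: dvdnP => [[q iE]|Nri].
  have q_gt0 : (0 < q)%N by case: q iE.
  have -> : (i %/ r = q.-1)%N.
    have -> : i = (q.-1 * r + r.-1)%N by nia.
    by rewrite divnMDl // divn_small ?prednK // addn0.
  rewrite coefXn iE; have [->|mq] := eqVneq m q.-1.
    by rewrite prednK // [(r * q)%N]mulnC -iE ltnSn subnn.
  case: ifP => // lt_i; case: eqP => // /eqP; rewrite subn_eq0 => le_i.
  have : (r * m.+1 == r * q)%N by rewrite eqn_leq [(r * q)%N]mulnC le_i lt_i.
  by rewrite eqn_pmul2l // => /eqP qE; lia.
rewrite coef0; case: ifP => // lt_i; case: eqP => // E.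
by case: Nri; exists m.+1; lia.
Qed.

End Sect.

Lemma sect_cross (R : realType) (r L n : nat) (z : R[i]) : (L <= r)%N ->
  (0 < r)%N -> 0 <= complex.Im z ->
  let F i : R[i] := (map_poly (real_complex R)
                       (sect r i ((\sum_(j < L) 'X^j) ^+ n))).[z] in
  forall i j, (i <= j <= i + r)%N -> 0 <= cross (F i) (F j).
Proof.
move=> Lr r0 Imz; elim: n => [|n IHn] F i j ij; rewrite /F.
  rewrite !sect1 //.
  case: ifP => [/dvdnP[a iE]|_]; last by rewrite rmorph0 horner0 cross0l.
  case: ifP => [/dvdnP[b jE]|_]; last by rewrite rmorph0 horner0 cross0r.
  (* [i + 1] and [j + 1] are multiples of [r] at distance at most [r]. So [j] is [i], or [i + r],
     where the value gains a factor [z]. *)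
  have : b = a \/ b = a.+1 by nia.
  case=> bE; rewrite bE in jE.
    have -> : j = i by lia.
    by rewrite crossxx.
  have -> : j = (i + r)%N by lia.
  rewrite divnDr // divnn r0 addn1 !map_polyXn !hornerXn exprS crossxM.
  by rewrite mulr_ge0 // addr_ge0 // sqr_ge0.
rewrite exprS !sect_geom_mul // !rmorph_sum !horner_sum.
pose G i : R[i] := (map_poly (real_complex R)
                      (sect r i ((\sum_(j < L) 'X^j) ^+ n))).[z].
apply: (@cross_window R r z G) => // k.
by rewrite /G sect_addr // rmorphM /= map_polyX hornerM hornerX.
Qed.

Lemma coef_geom_exp_gt0 (R : numDomainType) (l n m : nat) :
  (m <= n * l)%N -> 0 < ((\sum_(i < l.+1) 'X^i) ^+ n : {poly R})`_m.
Proof.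
have coef_ge0 k t : 0 <= ((\sum_(i < l.+1) 'X^i) ^+ k : {poly R})`_t.
  elim: k t => [|k IHk] t; first by rewrite expr0 coef1 ler0n.
  rewrite exprS mulr_suml coef_sum; apply: sumr_ge0 => i _.
  by rewrite coefXnM; case: ifP.
elim: n m => [|n IHn] m le_m; first by rewrite expr0 coef1; case: m le_m.
(* The exponent [minn l m] leaves at most [n * l] to the inductive hypothesis; the other summands
   are nonnegative. *)
have j_lt : (minn l m < l.+1)%N by rewrite ltnS geq_minl.
rewrite exprS mulr_suml coef_sum (bigD1 (Ordinal j_lt)) //= ltr_wpDr //.
  by apply: sumr_ge0 => i _; rewrite coefXnM; case: ifP.
rewrite coefXnM ifF; last by lia.
by apply: IHn; nia.
Qed.

Lemma size_geom_exp (R : idomainType) (l n : nat) :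
  size ((\sum_(i < l.+1) 'X^i) ^+ n : {poly R}) = (n * l).+1.
Proof.
have sz : size (\sum_(i < l.+1) 'X^i : {poly R}) = l.+1.
  have -> : \sum_(i < l.+1) 'X^i = \poly_(i < l.+1) 1 :> {poly R}.
    by rewrite poly_def; apply: eq_bigr => i _; rewrite scale1r.
  by rewrite size_poly_eq ?oner_eq0.
have nz : \sum_(i < l.+1) 'X^i != 0 :> {poly R} by rewrite -size_poly_eq0 sz.
have := size_exp (\sum_(i < l.+1) 'X^i : {poly R}) n.
rewrite sz /= mulnC => <-; rewrite prednK // size_poly_gt0.
exact: expf_neq0.
Qed.

(** * Local behaviour at a zero *)

Lemma poly_ge0_at0 (R : realFieldType) (p : {poly R}) (d : R) :
  0 < d -> (forall t, 0 < t -> t < d -> 0 <= p.[t]) -> 0 <= p.[0].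
Proof.
move=> d_gt0 p_ge0; rewrite leNgt; apply/negP => p0_lt0.
have /factor_theorem[q] : root (p - p.[0]%:P) 0.
  by rewrite /root !hornerE subrr.
move/eqP; rewrite subr_eq => /eqP pE.
have [M qM] := poly_disk_bound q 1.
have M_ge0 : 0 <= M by apply: le_trans (qM 0 _); rewrite ?normr0 ?ler01.
(* As [M] bounds [q] on the unit disk, this [e] keeps [p.[e] = c + e * q.[e]] negative. *)
pose c := p.[0]; pose e := Num.min (d / 2) (Num.min 1 (- c / (M + 1) / 2)).
have e_gt0 : 0 < e.
  rewrite !lt_min ltr01 !divr_gt0 ?ltr0n ?oppr_gt0 //; lra.
have e_le1 : e <= 1 by rewrite !ge_min lexx orbT.
have e_ltd : e < d by rewrite gt_min ltr_pdivrMr ?ltr0n // ltr_pMr // ltr1n.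
have e_lec : e * (M + 1) <= - c / 2.
  rewrite -ler_pdivlMr; last by lra.
  by rewrite mulrAC !ge_min lexx !orbT.
have := p_ge0 e e_gt0 e_ltd; rewrite pE !hornerE -/c.
have : q.[e] <= M by apply: le_trans (ler_norm _) (qM _ _); rewrite gtr0_norm.
rewrite -/c in p0_lt0 *; nra.
Qed.

Section Local.

Variable R : realType.
Implicit Types (f g : {poly R}) (F G Q : {poly R[i]}).

Lemma complex_poly_parts F :
  exists p q : {poly R}, forall t : R, F.[t%:C%C] = Complex p.[t] q.[t].
Proof.
elim/poly_ind: F => [|F [a b] [p [q E]]].
  by exists 0, 0 => t; rewrite !horner0.
exists (p * 'X + a%:P), (q * 'X + b%:P) => t.
rewrite !hornerE E; apply/eqP; rewrite eq_complex /=.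
by apply/andP; split; apply/eqP; ring.
Qed.

(* [G << F]; equivalently, [F / G] maps the upper half-plane to its closure. *)
Definition upper_cross G F :=
  forall z : R[i], 0 < complex.Im z -> 0 <= cross G.[z] F.[z].

(** On the ray [z + t * u] the factor [('X - z) ^+ m] equals [t ^+ m * u ^+ m]; divide by [t ^+ m]
    and let [t] decrease to 0. *)
Lemma cross_local G Q m (z u : R[i]) :
    upper_cross G (Q * ('X - z%:P) ^+ m) ->
    0 < complex.Im z \/ complex.Im z = 0 /\ 0 < complex.Im u ->
  0 <= cross G.[z] (u ^+ m * Q.[z]).
Proof.
move=> GQ zu.
have [d d_gt0 dP] : exists2 d : R, 0 < d &
    forall t, 0 < t -> t < d -> 0 < complex.Im (z + t%:C%C * u).
  case: z u zu {GQ} => a b [c e] /= [b_gt0|[-> e_gt0]]; last first.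
    exists 1 => // t t_gt0 _; have := mulr_gt0 t_gt0 e_gt0; lra.
  have e_gt0 : 0 < 1 + `|e| by have := normr_ge0 e; lra.
  exists (b / (1 + `|e|)); rewrite ?divr_gt0 // => t t_gt0.
  rewrite ltr_pdivlMr // => tb; have : - `|e| <= e by rewrite lerNl ler_normr lexx orbT.
  by move: (`|e|) tb => ?; nra.
pose lin := u *: 'X + z%:P.
have linE (t : R) : lin.[t%:C%C] = z + t%:C%C * u by rewrite !hornerE addrC mulrC.
have [p1 [q1 E1]] := complex_poly_parts (G \Po lin).
have [p2 [q2 E2]] := complex_poly_parts ((u ^+ m *: Q) \Po lin).
have crossE t : (p1 * q2 - q1 * p2).[t] =
    cross G.[z + t%:C%C * u] (u ^+ m * Q.[z + t%:C%C * u]).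
  move: (E1 t) (E2 t); rewrite !horner_comp hornerZ linE => -> ->.
  by rewrite /cross !hornerE.
have := crossE 0; rewrite mul0r addr0 => <-; apply: poly_ge0_at0 d_gt0 _ => t t_gt0 td.
have := GQ _ (dP t t_gt0 td).
rewrite crossE hornerM horner_exp hornerXsubC [z + _]addrC addrK exprMn mulrCA.
rewrite [Q.[_] * _]mulrC -rmorphXn.
have -> (a b : R[i]) (x : R) : cross a (x%:C%C * b) = x * cross a b.
  by case: a b => ? ? [? ?]; rewrite /cross /=; ring.
by rewrite pmulr_rge0 // exprn_gt0.
Qed.

Lemma upper_cross_root G F (z : R[i]) :
  upper_cross G F \/ upper_cross F G -> F != 0 -> 0 < complex.Im z ->
  root F z -> root G z.
Proof.
move=> GF F_neq0 Imz rootF; wlog GF1 : G GF / upper_cross G F => [wlog_G|].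
  case: (GF) => [?|FG]; first exact: wlog_G.
  have NGF : upper_cross (- G) F.
    move=> x /FG; rewrite hornerN crossC.
    by case: F.[x] G.[x] => ? ? [? ?]; rewrite /cross /=; lra.
  by rewrite -rootN; apply: (wlog_G _ _ NGF); left.
move: GF1 => {}GF; apply: contraT => Gz.
have [m [Q]] := multiplicity_XsubC F z; rewrite F_neq0 /= => Qz FE.
have m_gt0 : (0 < m)%N.
  by case: m FE => // FE; move: Qz; rewrite -[Q]mulr1 -FE rootF.
(* The direction [u] is chosen so that [u ^+ m * Q.[z] = - 'i * G.[z]], which makes the local cross
   term -|G(z)|^2. *)
rewrite FE in GF; have := @cross_local G Q m z (m.-root (- 'i%C * G.[z] / Q.[z])) GF.
rewrite rootCK // divfK // crossxM /= => /(_ (or_introl Imz)).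
rewrite mulrN1 oppr_ge0 leNgt => /negP[].
rewrite lt0r paddr_eq0 ?sqr_ge0 // !sqrf_eq0 addr_ge0 ?sqr_ge0 // andbT.
by move: Gz; rewrite /root eq_complex.
Qed.

End Local.

(* For [m > 1] the roots of ['X^m - c] sum to zero, so they cannot all lie in the
   lower half-plane. *)
Lemma exists_root_upper (R : realType) (m : nat) (c : R[i]) : (1 < m)%N ->
  complex.Im c != 0 -> exists2 u, 0 < complex.Im u & u ^+ m = c.
Proof.
move=> m_gt1 Imc.
have [rs] := closed_field_poly_normal ('X^m - c%:P).
rewrite (monicP (monicXnsubC _ (ltnW m_gt1))) scale1r => rsE.
have sz : size rs = m.
  apply/eqP; rewrite -eqSS -(size_prod_XsubC rs id) -rsE size_XnsubC //.
  exact: ltnW.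
have powE x : x \in rs -> x ^+ m = c.
  move=> xrs; apply/eqP; rewrite -subr_eq0.
  have : root (\prod_(z <- rs) ('X - z%:P)) x by rewrite root_prod_XsubC.
  by rewrite -rsE /root !hornerE.
have ImD : {morph (@complex.Im R) : x y / x + y >-> x + y} by case=> ? ? [].
have sum0 : \sum_(x <- rs) complex.Im x = 0.
  rewrite -(big_morph (@complex.Im R) ImD (erefl : complex.Im 0 = 0)).
  have -> : \sum_(x <- rs) x = 0.
    apply/eqP; rewrite -oppr_eq0 -coefPn_prod_XsubC sz -?lt0n ?(ltnW m_gt1) //.
    rewrite -rsE coefB coefXn coefC; case: m m_gt1 {sz rsE powE} => // -[] //= m _.
    by rewrite (ltn_eqF (ltnSn _)) subrr.
  by [].
have [/hasP[x xrs Imx]|/hasPn Im_le0] := boolP (has (fun x => 0 < complex.Im x) rs).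
  by exists x; rewrite ?powE.
(* A real root would make [c] real, so every imaginary part is strictly negative, against their sum
   being zero. *)
have Im_lt0 x : x \in rs -> complex.Im x < 0.
  move=> xrs; rewrite lt_neqAle leNgt Im_le0 // andbT; apply: contra Imc => /eqP Imx.
  have -> : c = (complex.Re x ^+ m)%:C%C.
    by rewrite -(powE x xrs) rmorphXn; case: x Imx {xrs} => ? ? /= ->.
  by [].
case: rs sz sum0 Im_lt0 {rsE powE Im_le0} => [|x s].
  by move=> m0; rewrite -m0 in m_gt1.
rewrite big_cons => _ sum0 Im_lt0; have := Im_lt0 x (mem_head _ _).
have : \sum_(y <- s) complex.Im y <= 0.
  rewrite big_seq; apply: sumr_le0 => y ys.
  by apply/ltW/Im_lt0; rewrite in_cons ys orbT.
by move=> ? ?; exfalso; lra.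
Qed.

Section RealLocal.

Variable R : realType.
Implicit Types (f g : {poly R}) (s : seq R).

Let horner_toC f (x : R) : (toC f).[x%:C%C] = f.[x]%:C%C.
Proof. exact: horner_map. Qed.

(** A zero of order [m > 1] is impossible: [u ^+ m] takes both values i and -i on the upper
    half-plane, forcing opposite signs of [g.[w] * q.[w]]. For a simple zero, [u = 'i] gives the
    sign. *)
Lemma upper_cross_deriv_gt0 g f w : upper_cross (toC g) (toC f) -> f != 0 ->
  f.[w] = 0 -> g.[w] != 0 -> 0 < f^`().[w] * g.[w].
Proof.
move=> gf f_neq0 fw gw.
have [m [q]] := multiplicity_XsubC f w; rewrite f_neq0 /= => qw fE.
have m_gt0 : (0 < m)%N.
  by case: m fE => // fE; move: qw; rewrite /root -[q]mulr1 -fE fw eqxx.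
have Im_pow (u : R[i]) : 0 < complex.Im u -> 0 <= g.[w] * q.[w] * complex.Im (u ^+ m).
  move=> Imu; have := @cross_local R (toC g) (toC q) m w%:C%C u.
  have -> : toC q * ('X - (w%:C%C)%:P) ^+ m = toC f.
    by rewrite fE rmorphM rmorphXn rmorphB /= map_polyX map_polyC.
  move=> /(_ gf (or_intror (conj (erefl _) Imu))).
  rewrite !horner_toC; case: (u ^+ m) => a b; rewrite /cross /=.
  by congr (0 <= _); ring.
have gq_neq0 : g.[w] * q.[w] != 0 by rewrite mulf_neq0.
have [m_gt1|m_le1] := ltnP 1 m.
  have [|u Imu uE] := @exists_root_upper R m 'i%C m_gt1; first by rewrite /= oner_neq0.
  have [|v Imv vE] := @exists_root_upper R m (- 'i%C) m_gt1.
    by rewrite /= oppr_eq0 oner_neq0.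
  have := Im_pow u Imu; have := Im_pow v Imv; rewrite uE vE /= => ? ?.
  by case/eqP: gq_neq0; lra.
have mE : m = 1%N by lia.
have := Im_pow 'i%C; rewrite mE /= mulr1 => /(_ ltr01) gq_ge0.
have -> : f^`().[w] = q.[w].
  by rewrite fE mE expr1 derivM derivXsubC !hornerE subrr mulr0 add0r.
by rewrite mulrC lt0r gq_neq0.
Qed.

End RealLocal.

(** * From the half-plane condition to the zeros *)

Section Interlacing.

Variable R : realType.
Implicit Types (f g : {poly R}) (s u v : seq R).

Let horner_toC_mulXsub f (w : R) (z : R[i]) :
  (toC (f * ('X - w%:P))).[z] = (z - w%:C%C) * (toC f).[z].
Proof.
by rewrite rmorphM rmorphB /= map_polyX map_polyC hornerM hornerXsubC mulrC.
Qed.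

Lemma coef_mulXsub_top g (w : R) (n : nat) : (size (g * ('X - w%:P))%R <= n.+2)%N ->
  (size g <= n.+1)%N /\ g`_n = (g * ('X - w%:P))`_n.+1.
Proof.
have [->|g_neq0] := eqVneq g 0; first by rewrite mul0r size_poly0 !coef0.
rewrite size_Mmonic ?monicXsubC // size_XsubC addn2 /= ltnS => sz; split=> //.
by rewrite mulrBr coefB coefMX coefMC /= [g`_n.+1]nth_default // mul0r subr0.
Qed.

(* Peeling off the roots one at a time amounts to the expansion of [g / f] in
   partial fractions: its residues [g(w) / f'(w)] are positive. *)
Lemma cross_partial_fractions s g (b : R) (z : R[i]) : 0 < complex.Im z ->
    (forall w, w \in s -> w <= b) ->
    (size g <= (size s).+1)%N -> 0 <= g`_(size s) ->
    (forall w, w \in s -> 0 < (prodXsub s)^`().[w] * g.[w]) ->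
  0 <= cross (toC (prodXsub s)).[z] ((z - b%:C%C) * (toC g).[z]).
Proof.
move=> Imz; elim: s g => [|w s IHs] g s_le sz_g top_g res_g.
  rewrite big_nil (size1_polyC sz_g) rmorph1 map_polyC !hornerC /=.
  have -> (c : R) : cross 1 ((z - b%:C%C) * c%:C%C) = complex.Im z * c.
    by case: z {Imz} => x y; rewrite /cross /=; ring.
  by rewrite mulr_ge0 // ltW.
rewrite big_cons mulrC in res_g *; set f := prodXsub s in IHs res_g *.
have fw_gw : 0 < f.[w] * g.[w].
  have := res_g w (mem_head _ _).
  by rewrite derivM derivXsubC !hornerE subrr mulr0 add0r.
have fw_neq0 : f.[w] != 0 by apply: contraTneq fw_gw => ->; rewrite mul0r ltxx.
(* The residue at [w] of [g] divided by [f * ('X - w%:P)], where [f] no longer contains the factor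
   of [w]. *)
pose a := g.[w] / f.[w].
have a_ge0 : 0 <= a.
  have -> : a = f.[w] * g.[w] / f.[w] ^+ 2 by rewrite /a; field.
  by rewrite divr_ge0 ?sqr_ge0 // ltW.
have /factor_theorem[g1 g1E] : root (g - a *: f) w.
  by rewrite /root !hornerE /a divfK // subrr.
have sz_f : size f = (size s).+1 by rewrite size_prod_XsubC.
have sz_g1X : (size (g1 * ('X - w%:P))%R <= (size s).+2)%N.
  rewrite -g1E (leq_trans (size_polyD _ _)) // geq_max sz_g size_polyN.
  by rewrite (leq_trans (size_scale_leq _ _)) // sz_f leqnSn.
have [sz_g1 top_g1] := coef_mulXsub_top sz_g1X.
have gE : g = a *: f + g1 * ('X - w%:P) by rewrite -g1E addrC subrK.
have := IHs g1 _ sz_g1 _ _.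
rewrite top_g1 -g1E coefB coefZ [f`_ _]nth_default ?sz_f // mulr0 subr0.
have s_le' x : x \in s -> x <= b by move=> xs; rewrite s_le // in_cons xs orbT.
have res_g1 x : x \in s -> 0 < f^`().[x] * g1.[x].
  move=> xs; have := res_g x; rewrite in_cons xs orbT => /(_ isT).
  have fx : f.[x] = 0 by apply/eqP; rewrite -/(root f x) root_prod_XsubC.
  rewrite derivM derivXsubC gE !hornerE fx mulr0 add0r addr0 => h.
  have : 0 < (x - w) ^+ 2 * (f^`().[x] * g1.[x]) by move: h; congr (0 < _); ring.
  rewrite pmulr_rgt0 // lt0r sqr_ge0 andbT; apply: contraTneq h => /eqP.
  by rewrite sqrf_eq0 => /eqP ->; rewrite !(mul0r, mulr0) ltxx.
move=> /(_ s_le' top_g res_g1) IH.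
rewrite gE rmorphD /= map_polyZ hornerD hornerZ !horner_toC_mulXsub.
move: (toC f).[z] (toC g1).[z] IH => A B IH; have w_le := s_le w (mem_head _ _).
(* The first term is the inductive hypothesis times |z - w|^2; the second is the contribution of the
   pole [w], nonnegative because [w <= b]. *)
have -> : cross ((z - w%:C%C) * A) ((z - b%:C%C) * (a%:C%C * A + (z - w%:C%C) * B)) =
    ((complex.Re z - w) ^+ 2 + complex.Im z ^+ 2) * cross A ((z - b%:C%C) * B) +
    a * (complex.Re A ^+ 2 + complex.Im A ^+ 2) * (complex.Im z * (b - w)).
  by case: z A B {IH IHs Imz} => ? ? [? ?] [? ?]; rewrite /cross /=; ring.
have sq2_ge0 (x y : R) : 0 <= x ^+ 2 + y ^+ 2 by rewrite addr_ge0 ?sqr_ge0.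
apply: addr_ge0; first exact: mulr_ge0.
by apply: mulr_ge0; apply: mulr_ge0; rewrite ?subr_ge0 // ltW.
Qed.

(** Residues are known to be positive only where [g] does not vanish, so common zeros are cancelled
    first; each merely scales [cross] by |z - w|^2. *)
Lemma cross_mulXsub_of_upper_cross s g (b : R) : (forall w, w \in s -> w <= b) ->
    (size g <= (size s).+1)%N -> 0 <= g`_(size s) ->
    upper_cross (toC g) (toC (prodXsub s)) ->
  upper_cross (toC (prodXsub s)) (('X - (b%:C%C)%:P) * toC g).
Proof.
have [n le_n] := ubnP (size s); elim: n => // n IHn in s g le_n *.
move=> s_le sz_g top_g gf z Imz; rewrite hornerM hornerXsubC.
have [/hasP[w ws gw]|/hasPn s_g] := boolP (has (root g) s); last first.
  apply: cross_partial_fractions => // w ws.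
  apply: upper_cross_deriv_gt0 gf _ _ _; last exact: s_g.
    by rewrite monic_neq0 // monic_prod_XsubC.
  by apply/eqP; rewrite -/(root _ w) root_prod_XsubC.
have [s1 s_perm] : {s1 | perm_eq s (w :: s1)} by exists (rem w s); exact: perm_to_rem.
have sz_s : size s = (size s1).+1 by rewrite (perm_size s_perm).
have prodE : prodXsub s = prodXsub s1 * ('X - w%:P).
  by rewrite (perm_big _ s_perm) big_cons mulrC.
have s1_le x : x \in s1 -> x <= b.
  by move=> xs; rewrite s_le // (perm_mem s_perm) in_cons xs orbT.
have /factor_theorem[g1 g1E] := gw.
rewrite sz_s prodE g1E in sz_g top_g gf *.
have [sz_g1 top_g1] := coef_mulXsub_top sz_g.
rewrite -top_g1 in top_g.
have sq_gt0 x : 0 < complex.Im x ->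
    0 < complex.Re (x - w%:C%C) ^+ 2 + complex.Im (x - w%:C%C) ^+ 2.
  case: x => a c /= c_gt0; rewrite subr0.
  by have := sqr_ge0 (a - w); have := exprn_gt0 2 c_gt0; lra.
have g1f1 : upper_cross (toC g1) (toC (prodXsub s1)).
  move=> x Imx; have := gf x Imx.
  by rewrite !horner_toC_mulXsub crossMM pmulr_rge0 // sq_gt0.
have := IHn s1 g1 _ s1_le sz_g1 top_g g1f1 z Imz; rewrite hornerM hornerXsubC.
rewrite !horner_toC_mulXsub mulrCA crossMM pmulr_rge0 ?sq_gt0 //; apply.
by rewrite -ltnS -sz_s.
Qed.

Lemma zeros_interlace u v : sorted >=%R u -> sorted >=%R v ->
    (size v <= size u <= (size v).+1)%N ->
    upper_cross (toC (prodXsub v)) (toC (prodXsub u)) ->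
  (forall i, (i < size v)%N -> v`_i <= u`_i) /\
  (forall i, (i.+1 < size u)%N -> u`_i.+1 <= v`_i).
Proof.
have [n le_n] := ubnP (size u + size v); elim: n => // n IHn in u v le_n *.
case: u le_n => [|b u] le_n u_sorted v_sorted sz_uv vu.
  by case: v sz_uv {v_sorted vu le_n}.
have u_le w : w \in u -> w <= b.
  move: u_sorted => /= /order_path_min => /(_ (rev_trans le_trans)) /allP; exact.
have bu_le w : w \in b :: u -> w <= b.
  by rewrite in_cons => /predU1P[->|/u_le].
have sz_prod s : size (prodXsub s) = (size s).+1 by rewrite size_prod_XsubC.
have prodE : prodXsub (b :: u) = prodXsub u * ('X - b%:P) by rewrite big_cons mulrC.
have uv : upper_cross (toC (prodXsub u)) (toC (prodXsub v)).
  move=> z Imz.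
  have := cross_mulXsub_of_upper_cross bu_le _ _ vu Imz.
  rewrite sz_prod prodE /= hornerM hornerXsubC horner_toC_mulXsub crossMM.
  rewrite pmulr_rge0; last first.
    case: z Imz => x y /= y_gt0; rewrite subr0.
    by have := sqr_ge0 (x - b); have := exprn_gt0 2 y_gt0; lra.
  apply; first by case/andP: sz_uv.
  (* The coefficient in question is 0 if [v] is shorter than [b :: u], and the leading coefficient 1
     if the lengths agree. *)
  have [le_v|lt_v] := leqP (size v) (size u).
    by rewrite nth_default ?sz_prod.
  have -> : (size u).+1 = (size (prodXsub v)).-1.
    by rewrite sz_prod /=; case/andP: sz_uv => /= *; apply/eqP; rewrite eqn_leq lt_v.
  have /monicP := monic_prod_XsubC v xpredT id.
  by rewrite lead_coefE => ->; exact: ler01.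
(* With the roles exchanged, the induction yields every required inequality except that the head of
   [v] is at most [b]. *)
have [||||le_uv le_vu] := IHn v u _ _ _ _ uv.
- by move: le_n => /=; lia.
- exact: v_sorted.
- exact: path_sorted u_sorted.
- by move: sz_uv => /=; lia.
split=> i; last by rewrite /= ltnS => /le_uv.
case: i => [|i] /= lt_i; last exact: le_vu.
case: v {IHn le_n le_uv le_vu sz_uv} lt_i v_sorted vu uv => //= c v _ v_sorted vu uv.
(* If [b < c], the product over [b :: u] is positive at [c], and the sign rule makes the derivative
   at [c] of the product over [c :: v] negative; yet it is a product of factors [c - w >= 0]. *)
rewrite leNgt; apply/negP => bc.
have c_ge w : w \in v -> w <= c.
  move: v_sorted => /order_path_min => /(_ (rev_trans le_trans)) /allP; exact.
have prodbu_gt0 : 0 < (prodXsub (b :: u)).[c].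
  rewrite horner_prod big_seq; apply: prodr_gt0 => w /bu_le wb.
  by rewrite hornerXsubC; lra.
have : upper_cross (toC (- prodXsub (b :: u))) (toC (prodXsub (c :: v))).
  move=> z /vu; rewrite rmorphN hornerN crossC.
  by case: _.[z] _.[z] => ? ? [? ?]; rewrite /cross /=; lra.
move=> /upper_cross_deriv_gt0 => /(_ c).
rewrite monic_neq0 ?monic_prod_XsubC // hornerN oppr_eq0 gt_eqF //.
rewrite big_cons derivM derivXsubC !hornerE subrr !mul0r addr0 => /(_ isT erefl isT).
rewrite mulrN oppr_gt0 ltNge => /negP[]; rewrite mulr_ge0 ?(ltW prodbu_gt0) //.
rewrite horner_prod big_seq; apply: prodr_ge0 => w /c_ge wc.
by rewrite hornerXsubC; lra.
Qed.

End Interlacing.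

(** * Sections of powers of the geometric sum *)

(** The derivative of ['X^r - z%:P] vanishes at most at 0, which is not a root, so the polynomial is
    separable. *)
Lemma XnsubC_uniq_roots (R : realType) (r : nat) (z : R[i]) : (0 < r)%N -> z != 0 ->
  exists2 rs : seq R[i], size rs = r /\ uniq rs & forall w, w \in rs -> w ^+ r = z.
Proof.
move=> r_gt0 z_neq0; have [rs] := closed_field_poly_normal ('X^r - z%:P).
rewrite (monicP (monicXnsubC _ r_gt0)) scale1r => rsE; exists rs.
  split; first by apply/eqP; rewrite -eqSS -(size_prod_XsubC rs id) -rsE size_XnsubC.
  rewrite -separable_prod_XsubC -rsE unlock derivB derivC subr0 derivXn.
  rewrite -scaler_nat coprimepZr ?pnatr_eq0 -?lt0n // coprimep_expr //.
  rewrite coprimepX /root !hornerE expr0n gtn_eqF // sub0r oppr_eq0 //.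
move=> w wrs; apply/eqP; rewrite -subr_eq0.
have : root (prodXsub rs) w by rewrite root_prod_XsubC.
by rewrite -rsE /root !hornerE.
Qed.

Section Decomposition.

Variables (R : realType) (r l n : nat) (h : 'I_r -> {poly R}).
Hypothesis (l_lt_r : (l < r)%N).
Hypothesis hE : (\sum_(i < l.+1) 'X^i) ^+ n
  = \sum_(k < r) 'X^k * (h k \Po 'X^r) :> {poly R}.

Let r_gt0 : (0 < r)%N := leq_ltn_trans (leq0n l) l_lt_r.

Lemma sections_not_all_zero (z : R[i]) : z != 0 -> exists k, ~~ root (toC (h k)) z.
Proof.
move=> z_neq0; apply/existsP; apply: contraT; rewrite negb_exists => /forallP hz.
have [rs [sz_rs uniq_rs] rsP] := XnsubC_uniq_roots r_gt0 z_neq0.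
pose p : {poly R} := \sum_(i < l.+1) 'X^i.
have sz_p : size (toC p) = l.+1.
  by have := size_geom_exp R l 1; rewrite expr1 mul1n size_map_poly.
have p_neq0 : toC p != 0 by rewrite -size_poly_eq0 sz_p.
suff p_roots : all (root (toC p)) rs.
  have := max_poly_roots p_neq0 p_roots uniq_rs.
  by rewrite sz_p sz_rs ltnS leqNgt l_lt_r.
apply/allP => w /rsP wE.
have : (toC (\sum_(k < r) 'X^k * (h k \Po 'X^r))).[w] = 0.
  rewrite rmorph_sum horner_sum big1 // => k _.
  rewrite rmorphM /= map_comp_poly !map_polyXn hornerM horner_comp !hornerXn wE.
  by have := hz k; rewrite negbK => /rootP ->; rewrite mulr0.
by rewrite -hE rmorphXn horner_exp => /eqP; rewrite expf_eq0 => /andP[].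
Qed.

End Decomposition.

(** Positivity of all coefficients of [P] up to its degree means that [q] ends exactly at the last
    [m] with [m * r + k < size P]. *)
Lemma section_size_lead (R : numDomainType) (P q : {poly R}) (r k : nat) :
    (0 < r)%N -> (forall m, (m < size P)%N -> 0 < P`_m) ->
    (forall m, q`_m = P`_(m * r + k)) ->
  size q = (if k < size P then ((size P - k.+1) %/ r).+1 else 0)%N /\
  (q = 0 \/ 0 < lead_coef q).
Proof.
move=> r_gt0 P_gt0 qE; set d := (if _ then _ else _)%N.
have lt_d m : (m < d)%N = (m * r + k < size P)%N.
  rewrite /d; case: ifP => [kP|/negbT]; last first.
    by move: (size P) (m * r)%N => a b ka; lia.
  rewrite ltnS leq_divRL //; move: (size P) (m * r)%N kP => a b ka; lia.
have sz_q : size q = d.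
  apply/eqP; rewrite eqn_leq; apply/andP; split.
    apply/leq_sizeP => m; rewrite leqNgt lt_d -leqNgt => le_m.
    by rewrite qE nth_default.
  rewrite leqNgt; apply/negP => lt_q; have := lt_q; rewrite lt_d => /P_gt0.
  by rewrite -qE nth_default ?ltxx.
split=> //; case: (posnP d) => [d0|d_gt0].
  by left; apply/eqP; rewrite -size_poly_eq0 sz_q d0.
by right; rewrite lead_coefE qE sz_q P_gt0 // -lt_d prednK.
Qed.

(** * Real-rootedness and lists of zeros *)

Lemma real_rooted_zero_list (R : realType) (f : {poly R}) : f != 0 -> real_rooted f ->
  exists u, zero_list f u.
Proof.
move=> f_neq0 f_real; have [rs rsE] := closed_field_poly_normal (toC f).
pose u := sort >=%R (map (@complex.Re R) rs); exists u; split.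
  by apply: sort_sorted => x y; exact: le_total.
apply: (map_poly_inj (real_complex R)).
rewrite /= map_polyZ rsE lead_coef_map; congr (_ *: _).
have u_perm : perm_eq u (map (@complex.Re R) rs) by rewrite perm_sort.
rewrite (perm_big _ u_perm) big_map rmorph_prod big_seq [RHS]big_seq.
apply: eq_bigr => z zrs; rewrite rmorphB /= map_polyX map_polyC /=.
have : complex.Im z = 0.
  apply: f_real => //; rewrite rsE rootZ ?root_prod_XsubC //.
  by rewrite lead_coef_eq0 map_poly_eq0.
by case: z {zrs} => a b /= ->.
Qed.

(** Nonreal zeros of a real polynomial come in conjugate pairs. *)
Lemma real_rooted_upper (R : realType) (f : {poly R}) :
  (f != 0 -> forall z : R[i], 0 < complex.Im z -> ~~ root (toC f) z) -> real_rooted f.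
Proof.
move=> f_up f_neq0 z fz; have f_up0 := f_up f_neq0.
have fJ : map_poly conjc (toC f) = toC f.
  by rewrite -map_poly_comp; apply: eq_map_poly => x /=; rewrite oppr0.
have fzJ : root (toC f) (conjc z) by rewrite -complex_root_conj fJ.
have [Imz|Imz|//] := ltgtP (complex.Im z) 0; last by have := f_up0 z Imz; rewrite fz.
have : 0 < complex.Im (conjc z) by case: z Imz {fz fzJ} => a b /=; rewrite oppr_gt0.
by move/f_up0; rewrite fzJ.
Qed.

Lemma interlaces_of_upper_cross (R : realType) (g f : {poly R}) :
    real_rooted g -> real_rooted f -> 0 < lead_coef g -> 0 < lead_coef f ->
    size f = size g \/ size f = (size g).+1 ->
    upper_cross (toC g) (toC f) ->
  interlaces g f.
Proof.
move=> g_real f_real g_lc f_lc sz gf; apply: Or33; split=> //.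
have lc_neq0 (q : {poly R}) : 0 < lead_coef q -> q != 0.
  by move=> q_gt0; rewrite -lead_coef_eq0 gt_eqF.
have [u [u_sorted fE]] := real_rooted_zero_list (lc_neq0 f f_lc) f_real.
have [v [v_sorted gE]] := real_rooted_zero_list (lc_neq0 g g_lc) g_real.
have size_zeros (q : {poly R}) w : zero_list q w -> q != 0 -> size q = (size w).+1.
  by move=> [_ qE] q_neq0; rewrite qE size_scale ?lead_coef_eq0 // size_prod_XsubC.
have sz_u := size_zeros f u (conj u_sorted fE) (lc_neq0 f f_lc).
have sz_v := size_zeros g v (conj v_sorted gE) (lc_neq0 g g_lc).
have [|z Imz|le_vu le_uv] := zeros_interlace u_sorted v_sorted; last by exists u, v.
  by move: sz; rewrite sz_u sz_v => sz; lia.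
have := gf z Imz; rewrite {1}gE {1}fE /= !map_polyZ !hornerZ.
have -> (a b : R) (x y : R[i]) : cross (a%:C%C * x) (b%:C%C * y) = a * b * cross x y.
  by case: x y => ? ? [? ?]; rewrite /cross /=; ring.
by rewrite pmulr_rge0 // mulr_gt0.
Qed.

(* MathComp world.  [rev_ord k] is r - 1 - k, so the sequence below is
   (h_(r-1), ..., h_1, h_0). *)
Theorem corollary4 (R : realType) (r l n : nat) (h : 'I_r -> {poly R})
  (hr : (0 < r)%N) (hl : (0 < l)%N) (hlr : (l <= r - 1)%N) (hn : (0 < n)%N)
  (hh : (\sum_(i < l.+1) 'X^i) ^+ n
        = \sum_(k < r) 'X^k * (h k \Po 'X^r) :> {poly R}) :
  interlacing_sequence (fun k : 'I_r => h (rev_ord k)).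
Proof.
have l_lt_r : (l < r)%N by lia.
pose P : {poly R} := (\sum_(i < l.+1) 'X^i) ^+ n.
have h_sz k : size (h k) = (if k < size P then ((size P - k.+1) %/ r).+1 else 0)%N /\
    (h k = 0 \/ 0 < lead_coef (h k)).
  apply: section_size_lead => // m.
    by rewrite size_geom_exp ltnS => /coef_geom_exp_gt0.
  by rewrite /P hh coef_sum_mul_comp_Xn.
have h_cross (i j : 'I_r) : (i <= j)%N ->
    upper_cross (toC (h (rev_ord i))) (toC (h (rev_ord j))).
  move=> ij z /ltW Imz; rewrite -!(sect_decomposition hr) -hh.
  by apply: (sect_cross n l_lt_r hr Imz); rewrite ij ltnW // ltn_addl.
have h_real k : real_rooted (h k).
  (* A zero in the upper half-plane would be shared by all the sections, since any two of them are
     comparable in one order or the other. *)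
  apply: real_rooted_upper => hk_neq0 z Imz; apply/negP => hkz.
  have z_neq0 : z != 0 by apply: contraTneq Imz => ->; rewrite ltxx.
  have [j /negP[]] := sections_not_all_zero l_lt_r hh z_neq0.
  apply: upper_cross_root hkz => //; last by rewrite map_poly_eq0.
  rewrite -(rev_ordK j) -(rev_ordK k).
  by have [|/ltnW] := leqP (rev_ord j) (rev_ord k); [left | right]; apply: h_cross.
split=> [i|i j ij]; first by have [] := h_sz (rev_ord i).
have [szi hi] := h_sz (rev_ord i); have [szj hj] := h_sz (rev_ord j).
case: hi => [->|hi]; first by apply: Or31.
case: hj => [->|hj]; first by apply: Or32.
apply: interlaces_of_upper_cross => //; last exact/h_cross/ltnW.
have lt_i : (r - i.+1 < size P)%N.
  apply: contraTT hi => /negbTE lt_i; move: szi; rewrite /= lt_i => /eqP.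
  by rewrite size_poly_eq0 => /eqP ->; rewrite lead_coef0 ltxx.
rewrite szi szj /= lt_i; have lt_jr := ltn_ord j.
move: (size P) lt_i => N lt_i.
rewrite ifT; last by lia.
set a := (N - (r - i.+1).+1)%N; set b := (N - (r - j.+1).+1)%N.
(* As [a <= b <= a + r], the quotients differ by at most one: these are the two degree cases of
   interlacing. *)
have ab : (a %/ r <= b %/ r)%N by apply: leq_div2r; lia.
have ba : (b %/ r <= (a + r) %/ r)%N by apply: leq_div2r; lia.
rewrite divnDr // divnn hr addn1 in ba.
by lia.
Qed.
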